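(* Let $F$ be a quasi-finite field of characteristic $p>0$, with algebraic closure $F^a$. Assume $F$ does not contain the field $\bigcup_{n\in\mathbb N}\mathbb F_{p^{p^n}}\subseteq F^a$ (the maximal abelian $p$-extension of the prime field $\mathbb F_p$). Then $p$ is not geometrically represented in $\mathrm{Th}(F)$.
   Context: A field $F$ is quasi-finite if it is perfect and, for every integer $n\ge1$, has exactly one extension of degree $n$ inside $F^a$. For a complete theory $T$ (here in the language of rings), a prime $p$ is geometrically represented in $T$ if there exist models $M_0\prec M\models T$ and substructures $M_0\le A\le B\le M$ with $B\subseteq \mathrm{acl}(A)$ such that $\mathrm{Aut}(B/A)\cong \mathbb Z/p\mathbb Z$; here $\mathrm{Aut}(B/A)$ denotes the group of permutations of $B$ fixing $A$ pointwise and preserving the truth value (computed in $M$) of every first-order formula with parameters from $B$. *)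

(* Defs.v *)
From HB Require Import structures.
From mathcomp Require Import all_boot all_algebra all_field.
From mathcomp Require Import boolp classical_sets cardinality.

Set Implicit Arguments.
Unset Strict Implicit.
Unset Printing Implicit Defensive.

Import GRing.Theory.

Local Open Scope classical_set_scope.
Local Open Scope ring_scope.

(* [GRing.formula R] is not used: its terms contain all elements of [R] as
   constants, and an inversion symbol.  Here a formula of type [rformula n]
   is parameter-free and has its free variables among [n] variables. *)

Inductive rterm (n : nat) : Type :=
| TVar of 'I_n
| TZero
| TOne
| TAdd of rterm n & rterm n
| TOpp of rterm n
| TMul of rterm n & rterm n.

Inductive rformula (n : nat) : Type :=
| FEq of rterm n & rterm n
| FFalse
| FNot of rformula n
| FAnd of rformula n & rformula n
| FOr of rformula n & rformula n
| FImp of rformula n & rformula n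
| FAll of rformula n.+1
| FEx of rformula n.+1.

Arguments TZero {n}.
Arguments TOne {n}.
Arguments FFalse {n}.

Record rstruct := RStruct {
  rs_sort :> Type;
  rs_zero : rs_sort;
  rs_one : rs_sort;
  rs_add : rs_sort -> rs_sort -> rs_sort;
  rs_opp : rs_sort -> rs_sort;
  rs_mul : rs_sort -> rs_sort -> rs_sort }.

Definition ring_rstruct (R : pzRingType) : rstruct :=
  @RStruct R 0 1 +%R -%R *%R.

(* A quantifier binds variable [ord0]; variable [i] of the context becomes
   variable [lift ord0 i] under it. *)
Definition env_cons (X : Type) (n : nat) (a : X) (v : 'I_n -> X)
    (i : 'I_n.+1) : X :=
  if unlift ord0 i is Some j then v j else a.

Section Semantics.
Variable M : rstruct.

Fixpoint teval (n : nat) (t : rterm n) (v : 'I_n -> M) : M :=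
  match t with
  | TVar i => v i
  | TZero => rs_zero M
  | TOne => rs_one M
  | TAdd t1 t2 => rs_add (teval t1 v) (teval t2 v)
  | TOpp t1 => rs_opp (teval t1 v)
  | TMul t1 t2 => rs_mul (teval t1 v) (teval t2 v)
  end.

Fixpoint sat (n : nat) (f : rformula n) : ('I_n -> M) -> Prop :=
  match f with
  | FEq t1 t2 => fun v => teval t1 v = teval t2 v
  | FFalse => fun _ => False
  | FNot f1 => fun v => ~ sat f1 v
  | FAnd f1 f2 => fun v => sat f1 v /\ sat f2 v
  | FOr f1 f2 => fun v => sat f1 v \/ sat f2 v
  | FImp f1 f2 => fun v => sat f1 v -> sat f2 v
  | FAll f1 => fun v => forall a : M, sat f1 (env_cons a v)
  | FEx f1 => fun v => exists a : M, sat f1 (env_cons a v)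
  end.

(* There are no variables to assign: the value [rs_zero M] is never used. *)
Definition models (f : rformula 0) : Prop := sat f (fun=> rs_zero M).

Definition Th : set (rformula 0) := [set f | models f].

Definition models_theory (T : set (rformula 0)) : Prop :=
  forall f, T f -> models f.

Record substruct := Substruct {
  ss_set :> set M;
  ss_zero : ss_set (rs_zero M);
  ss_one : ss_set (rs_one M);
  ss_add : forall x y, ss_set x -> ss_set y -> ss_set (rs_add x y);
  ss_opp : forall x, ss_set x -> ss_set (rs_opp x);
  ss_mul : forall x y, ss_set x -> ss_set y -> ss_set (rs_mul x y) }.

Definition in_subset (A : set M) (x : M) (h : A x) : set_type A :=
  exist (fun y => y \in A) x (mem_set h).

Definition induced_rstruct (A : substruct) : rstruct :=
  @RStruct (set_type A)
    (in_subset (ss_zero A))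
    (in_subset (ss_one A))
    (fun x y => in_subset (ss_add (set_mem (valP x)) (set_mem (valP y))))
    (fun x => in_subset (ss_opp (set_mem (valP x))))
    (fun x y => in_subset (ss_mul (set_mem (valP x)) (set_mem (valP y)))).

(* [b] satisfies a formula with parameters in [A] (variable [ord0] is the
   free one) that has only finitely many solutions in [M]. *)
Definition acl (A : set M) : set M :=
  [set b | exists (n : nat) (f : rformula n.+1) (a : 'I_n -> M),
     [/\ forall i, A (a i),
         sat f (env_cons b a)
       & finite_set [set x : M | sat f (env_cons x a)]]].

Definition elem_aut (A B : set M) : set (set_type B -> set_type B) :=
  [set s : set_type B -> set_type B | [/\ bijective s,
     forall x : set_type B, A (val x) -> s x = x
   & forall (n : nat) (f : rformula n) (b : 'I_n -> set_type B),
       sat f (fun i => val (b i)) <-> sat f (fun i => val (s (b i)))]].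

(* ['Z_p] is Z/pZ only for [1 < p]. *)
Definition elem_aut_isog_Zp (A B : set M) (p : nat) : Prop :=
  exists h : 'Z_p -> (set_type B -> set_type B),
    [/\ injective h,
        range h = @elem_aut A B
      & forall i j : 'Z_p, h (i + j) = h i \o h j].

End Semantics.

Definition elementary_substruct (M : rstruct) (M0 : substruct M) : Prop :=
  forall (n : nat) (f : rformula n) (v : 'I_n -> induced_rstruct M0),
    sat f v <-> @sat M n f (fun i => val (v i)).

Definition geometrically_represented (T : set (rformula 0)) (p : nat) : Prop :=
  exists (M : rstruct) (M0 A B : substruct M),
    [/\ models_theory M T, elementary_substruct M0,
        [/\ M0 `<=` A, A `<=` B & B `<=` acl A]
      & elem_aut_isog_Zp A B p].

Definition is_subfield (E : fieldType) (K : set E) : Prop :=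
  divring_closed [pred x | x \in K].

Definition is_algebraic_closure (F : fieldType) (Fa : closedFieldType)
    (iota : {rmorphism F -> Fa}) : Prop :=
  forall x : Fa, algebraicOver iota x.

Definition perfect_field (F : fieldType) : Prop :=
  forall q : {poly F}, irreducible_poly q -> separable_poly q.

Definition extension_of_degree (F E : fieldType) (iota : {rmorphism F -> E})
    (n : nat) (K : set E) : Prop :=
  [/\ is_subfield K,
      range iota `<=` K
    & exists b : 'I_n -> E, (forall i, K (b i)) /\
        forall x, K x ->
          exists! c : {ffun 'I_n -> F}, x = \sum_(i < n) iota (c i) * b i].

Definition quasi_finite (F : fieldType) (Fa : closedFieldType)
    (iota : {rmorphism F -> Fa}) : Prop :=
  perfect_field F /\
  forall n : nat, (0 < n)%N -> exists! K : set Fa, extension_of_degree iota n K.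

(* The subfield with [q] elements: there is at most one in [E]. *)
Definition finite_subfield (E : fieldType) (q : nat) : set E :=
  [set x | exists K : set E, [/\ is_subfield K, (K #= `I_q)%card & K x]].
Arguments finite_subfield : clear implicits.

Definition max_abelian_pext (E : fieldType) (p : nat) : set E :=
  \bigcup_(n in [set: nat]) finite_subfield E (p ^ (p ^ n))%N.
Arguments max_abelian_pext : clear implicits.

(* Main.v *)
Require Import Defs.
From HB Require Import structures.
From mathcomp Require Import all_boot all_algebra all_field.
From mathcomp Require Import boolp classical_sets cardinality.

Set Implicit Arguments.
Unset Strict Implicit.
Unset Printing Implicit Defensive.

Import GRing.Theory.

Local Open Scope classical_set_scope.
Local Open Scope ring_scope.

(* Write P y := y ^+ p - y.  On the algebraic closure, P is Frobenius minus the
   identity, so P iterated p ^ n times kills the field with p ^ (p ^ n)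
   elements; were P onto F, descending along P would put all these fields
   inside F.  So some a in F is not of the form P y, and uniqueness of the
   extension of degree p makes F the union of the cosets i * a + P(F), i < p.
   This passes to M, with a in M0: the coset of a * c is then definable from
   c over M0, and it differs from the coset of a * (c + 1).
   An elementary map s of B of order p over A has (s - 1)^p = s^p - 1 = 0, so
   there are u, v in B with s u = u + v and s v = v != 0.  Then c := u / v is
   sent to c + 1, although s preserves the coset of a * c. *)

(** * Iterated differences in prime characteristic *)

Section IteratedDifferences.
Variable R : comNzRingType.

Fixpoint iter_diff (n : nat) (s : nat -> R) (j : nat) : R :=
  if n is m.+1 then iter_diff m s j.+1 - iter_diff m s j else s j.

(* The functional ['X^k |-> s k] turns the difference operator into
   multiplication by ['X - 1], whose [N]-th power is ['X^N - 1]. *)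
Lemma iter_diff_pchar_nat (s : nat -> R) (N : nat) :
  [pchar R].-nat N -> iter_diff N s 0 = s N - s 0.
Proof.
move=> pcharN.
pose L (q : {poly R}) := \sum_(k < size q) q`_k * s k.
have LE (q : {poly R}) n : (size q <= n)%N -> L q = \sum_(k < n) q`_k * s k.
  move=> le_qn; rewrite /L (big_ord_widen n (fun k => q`_k * s k)) //.
  rewrite big_mkcond; apply: eq_bigr => k _.
  by case: ltnP => // le_qk; rewrite nth_default ?mul0r.
have LB (q r : {poly R}) : L (q - r) = L q - L r.
  pose n := maxn (size q) (size r).
  have le_n : (size (q - r)%R <= n)%N.
    by rewrite (leq_trans (size_polyD _ _)) // size_polyN.
  rewrite (@LE _ n le_n) (@LE q n (leq_maxl _ _)) (@LE r n (leq_maxr _ _)).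
  by rewrite -sumrB; apply: eq_bigr => k _; rewrite coefB mulrBl.
have LX j : L 'X^j = s j.
  rewrite (@LE _ j.+1) ?size_polyXn // big_ord_recr /= big1 ?add0r => [|k _].
    by rewrite coefXn eqxx mul1r.
  by rewrite coefXn (ltn_eqF (ltn_ord k)) mul0r.
have diffE n j : iter_diff n s j = L ('X^j * ('X - 1) ^+ n).
  elim: n j => [|n IHn] j /=; first by rewrite expr0 mulr1 LX.
  by rewrite !IHn -LB exprSr [in RHS]exprS mulrBl mul1r mulrBr mulrA.
have expB (A : comNzRingType) (u : A) : [pchar A].-nat N -> (u - 1) ^+ N = u ^+ N - 1.
  (* That [(-1) ^+ N = -1] comes from [(1 - 1) ^+ N = 0], whatever the parity of [N]. *)
  move=> pcharA; rewrite exprDn_pchar //; congr (_ + _); apply/eqP.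
  rewrite -addr_eq0 addrC -{1}(expr1n A N) -exprDn_pchar // subrr expr0n.
  by rewrite gtn_eqF //; case/andP: pcharA.
rewrite diffE expr0 mul1r expB; last by rewrite (eq_pnat _ (pchar_poly R)).
by rewrite LB LX -(expr0 'X) LX.
Qed.

End IteratedDifferences.

(** * Artin-Schreier polynomials and the prime field *)

Section PrimeSubfield.
Variables (F : fieldType) (p : nat).
Hypothesis pcharF : p \in [pchar F].

Let p_gt0 : (0 < p)%N := prime_gt0 (pcharf_prime pcharF).
Let p_gt1 : (1 < p)%N := prime_gt1 (pcharf_prime pcharF).

Lemma natr_inj_pchar : {in gtn p &, injective (fun n : nat => n%:R : F)}.
Proof.
have le_inj m n : (m <= n)%N -> (n < p)%N -> m%:R = n%:R :> F -> m = n.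
  move=> le_mn lt_np eq_mn; apply/eqP; rewrite eqn_leq le_mn -subn_eq0.
  have : (p %| n - m)%N by rewrite (dvdn_pcharf pcharF) natrB // eq_mn subrr.
  case: (posnP (n - m)) => // d_gt0 /(dvdn_leq d_gt0).
  by rewrite leqNgt ltn_subLR ?ltn_addl.
move=> m n lt_mp lt_np eq_mn; case: (leqP m n) => [le_mn | /ltnW le_nm].
  exact: le_inj.
by symmetry; apply: le_inj.
Qed.

Lemma uniq_shifted_primes (x : F) : uniq [seq x + i%:R | i <- iota 0 p].
Proof.
rewrite map_inj_in_uniq ?iota_uniq // => i j; rewrite !mem_iota !add0n.
by move=> lti ltj /addrI; apply: natr_inj_pchar.
Qed.

Definition artin_schreier_poly (a : F) : {poly F} := 'X^p - 'X - a%:P.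

Lemma size_artin_schreier_poly a : size (artin_schreier_poly a) = p.+1.
Proof.
rewrite /artin_schreier_poly -addrA -opprD size_polyDl size_polyXn //.
by rewrite size_polyN size_XaddC.
Qed.

Lemma root_artin_schreier_poly a x :
  root (artin_schreier_poly a) x = (x ^+ p - x == a).
Proof. by rewrite /root !hornerE subr_eq0. Qed.

Lemma exprB_pchar (x y : F) : (x - y) ^+ p = x ^+ p - y ^+ p.
Proof.
by have := pFrobenius_autB_comm pcharF (mulrC x y); rewrite !pFrobenius_autE.
Qed.

Lemma exprD_pchar (x y : F) : (x + y) ^+ p = x ^+ p + y ^+ p.
Proof. by rewrite exprDn_pchar // pnatE ?(pcharf_prime pcharF). Qed.

Lemma natr_expr_pchar n : (n%:R : F) ^+ p = n%:R.
Proof. by rewrite -pFrobenius_autE pFrobenius_aut_nat. Qed.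

Lemma all_root_artin_schreier_poly x :
  all (root (artin_schreier_poly (x ^+ p - x))) [seq x + i%:R | i <- iota 0 p].
Proof.
apply/allP => _ /mapP[i _ ->]; rewrite root_artin_schreier_poly.
by rewrite exprD_pchar natr_expr_pchar opprD addrACA subrr addr0.
Qed.

Lemma artin_schreier_poly_factor x :
  artin_schreier_poly (x ^+ p - x) =
    \prod_(z <- [seq x + i%:R | i <- iota 0 p]) ('X - z%:P).
Proof.
rewrite {1}[LHS](@all_roots_prod_XsubC _ _ [seq x + i%:R | i <- iota 0 p]).
- rewrite (_ : lead_coef _ = 1) ?scale1r //.
  rewrite lead_coefE size_artin_schreier_poly /= !coefB coefXn eqxx coefX coefC.
  by rewrite (gtn_eqF p_gt1) (gtn_eqF p_gt0) !subr0.
- by rewrite size_map size_iota size_artin_schreier_poly.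
- exact: all_root_artin_schreier_poly.
- by rewrite uniq_rootsE uniq_shifted_primes.
Qed.

Lemma pchar_fixedP (x : F) : x ^+ p = x -> exists2 i, (i < p)%N & x = i%:R.
Proof.
move=> xp; have : root (artin_schreier_poly (0 ^+ p - 0)) x.
  by rewrite root_artin_schreier_poly xp expr0n (gtn_eqF p_gt0) !subrr.
rewrite artin_schreier_poly_factor root_prod_XsubC => /mapP[i].
by rewrite mem_iota add0r => ltip ->; exists i.
Qed.

(** Periodicity makes [q - q.[0]] vanish on the whole prime field, which is too many roots for its
    degree. *)
Lemma periodic_poly_const (q : {poly F}) :
  (size q <= p)%N -> q \Po ('X + 1) = q -> q = (q.[0])%:P.
Proof.
move=> le_qp qX.
have qn n : q.[n%:R] = q.[0].
  elim: n => // n <-; rewrite -{2}qX horner_comp !hornerE.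
  by rewrite -natr1.
apply/eqP; rewrite -subr_eq0; apply/idPn => nz.
have := max_poly_roots nz (rs := [seq 0 + i%:R | i <- iota 0 p]).
rewrite uniq_shifted_primes size_map size_iota => /(_ _ isT) lt_p.
have /lt_p : all (root (q - q.[0]%:P)) [seq 0 + i%:R | i <- iota 0 p].
  by apply/allP => _ /mapP[i _ ->]; rewrite /root !hornerE qn subrr.
rewrite ltnNge (leq_trans (size_polyD _ _)) // size_polyN geq_max le_qp.
by rewrite (leq_trans (size_polyC_leq1 _)).
Qed.

End PrimeSubfield.

(** * Simple algebraic extensions *)

Section SimpleExtension.
Variables (F E : fieldType) (iota : {rmorphism F -> E}).

Definition adjoin_root (b : E) : set E :=
  range (fun r : {poly F} => (map_poly iota r).[b]).

Variables (q : {poly F}) (b : E).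
Hypotheses (irr_q : irreducible_poly q) (qb : root (map_poly iota q) b).

Lemma root_irreducible_dvdp (r : {poly F}) :
  ((map_poly iota r).[b] == 0) = (q %| r).
Proof.
apply/idP/idP => [rb | /dvdpP[s ->]]; last first.
  by rewrite rmorphM hornerM (eqP qb) mulr0.
apply/idPn; rewrite -(irreducible_poly_coprime r irr_q) -(coprimep_map iota).
by move/coprimep_root/(_ qb)/negP.
Qed.

(** Inverses come from a Bezout relation between [q] and a polynomial it does not divide. *)
Lemma adjoin_root_is_subfield : is_subfield (adjoin_root b).
Proof.
split=> [|x y|x y]; rewrite !inE.
- by exists 1; rewrite ?rmorph1 ?hornerC.
- move=> [r _ <-] [s _ <-]; exists (r - s) => //.
  by rewrite rmorphB hornerD hornerN.
move=> [r _ <-] [s _ <-].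
have [s0 | nz_s] := eqVneq (map_poly iota s).[b] 0.
  by exists 0 => //; rewrite rmorph0 horner0 s0 invr0 mulr0.
have : coprimep q s.
  by rewrite irreducible_poly_coprime // -root_irreducible_dvdp.
case/Bezout_eq1_coprimepP => -[u v] /= /(congr1 (fun t => (map_poly iota t).[b])).
rewrite rmorphD !rmorphM rmorph1 hornerD !hornerM (eqP qb) mulr0 add0r hornerC.
move=> vs1; exists (r * v) => //; rewrite rmorphM hornerM; congr (_ * _).
by apply: (mulIf nz_s); rewrite vs1 mulVf.
Qed.

(** The powers of [b] below [n] form a basis; coordinates are read off from remainders modulo
    [q]. *)
Lemma adjoin_root_extension n :
  size q = n.+1 -> extension_of_degree iota n (adjoin_root b).
Proof.
move=> size_q; split; first exact: adjoin_root_is_subfield.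
  by move=> _ [a _ <-]; exists a%:P; rewrite ?map_polyC ?hornerC.
(* [oapp c 0 (insub i)] extends the coordinates [c] by 0 to all natural indices. *)
have polyE (c : {ffun 'I_n -> F}) (r := \poly_(i < n) oapp c 0 (insub i)) :
    (map_poly iota r).[b] = \sum_(i < n) iota (c i) * b ^+ i.
  rewrite (@horner_coef_wide _ n) ?size_map_poly ?size_poly //.
  by apply: eq_bigr => i _; rewrite coef_map coef_poly ltn_ord valK.
exists (fun i => b ^+ i); split=> [i | _ [r _ <-]].
  by exists 'X^i; rewrite ?map_polyXn ?hornerXn.
have rE (s : {poly F}) : (size s <= n)%N ->
    (map_poly iota s).[b] = \sum_(i < n) iota ([ffun i : 'I_n => s`_i] i) * b ^+ i.
  move=> le_sn; rewrite (@horner_coef_wide _ n) ?size_map_poly //.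
  by apply: eq_bigr => i _; rewrite coef_map ffunE.
have q_neq0 : q != 0 by rewrite -size_poly_eq0 size_q.
exists [ffun i : 'I_n => (r %% q)`_i]; split.
  rewrite -rE; last by rewrite -ltnS -size_q ltn_modp.
  rewrite {1}(divp_eq r q) rmorphD rmorphM hornerD hornerM (eqP qb) mulr0.
  by rewrite add0r.
move=> c; rewrite -polyE => /eqP; rewrite -subr_eq0 -hornerN -hornerD -rmorphB.
set s := \poly_(i < n) _; rewrite root_irreducible_dvdp => /modp_eq0P.
rewrite modpD modpN (@modp_small _ s) ?size_q ?ltnS ?size_poly // => /eqP.
rewrite subr_eq0 => /eqP rs; apply/ffunP => i.
by rewrite ffunE rs coef_poly ltn_ord valK.
Qed.

End SimpleExtension.

(** * Artin-Schreier theory over a quasi-finite field *)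

Section ArtinSchreier.
Variables (F : fieldType) (Fa : closedFieldType) (iota : {rmorphism F -> Fa}).
Variable p : nat.
Hypothesis pcharF : p \in [pchar F].

Let pcharFa : p \in [pchar Fa].
Proof. by rewrite (rmorph_pchar iota). Qed.

Lemma map_artin_schreier_poly a :
  map_poly iota (artin_schreier_poly p a) = artin_schreier_poly p (iota a).
Proof. by rewrite /artin_schreier_poly !rmorphB /= map_polyXn map_polyX map_polyC. Qed.

(* A proper factor of degree [d] has sum of roots [d * x + i] with [i] in the
   prime field; as [d] is invertible, [x] would lie in [F]. *)
Lemma artin_schreier_irreducible (a : F) :
  (forall y, y ^+ p - y != a) -> irreducible_poly (artin_schreier_poly p a).
Proof.
move=> no_root; have p_prime := pcharf_prime pcharF.
have size_q := size_artin_schreier_poly pcharF a.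
split=> [|g g_neq1 g_dvd]; first by rewrite size_q ltnS prime_gt0.
have [x] : exists x, root (artin_schreier_poly p (iota a)) x.
  apply/closed_rootP; rewrite size_artin_schreier_poly // eqSS.
  by rewrite gtn_eqF // prime_gt0.
rewrite root_artin_schreier_poly => /eqP xa.
have := g_dvd; rewrite -(dvdp_map iota) map_artin_schreier_poly -xa.
rewrite artin_schreier_poly_factor // big_map => /dvdp_prod_XsubC[m].
rewrite -(big_map (fun i : nat => x + i%:R) xpredT (fun z => 'X - z%:P)).
set r := mask m _; set s := map _ r => g_eqp.
have size_g : size g = (size r).+1.
  by rewrite -(size_map_poly iota) (eqp_size g_eqp) size_prod_XsubC size_map.
have r_gt0 : (0 < size r)%N by rewrite lt0n -eqSS -size_g.
have le_rp : (size r <= p)%N.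
  by rewrite -ltnS -size_g -size_q dvdp_leq // -size_poly_eq0 size_q.
rewrite -(dvdp_size_eqp g_dvd) size_g size_q eqSS eqn_leq le_rp leqNgt.
apply/negP => lt_rp.
have lead_s : lead_coef (\prod_(z <- s) ('X - z%:P)) = 1.
  by apply/eqP; exact: monic_prod_XsubC.
have [[c1 c2] /= /andP[nz1 nz2] gE] := elimT (eqpP _ _) g_eqp.
have r_neq0 : (size r)%:R != 0 :> F.
  by rewrite -(dvdn_pcharf pcharF) gtnNdvd.
(* [g] is the product only up to scalars; the ratio of its top two coefficients is free of them and
   gives minus the sum of the roots. *)
have := congr1 (fun t : {poly Fa} => t`_(size r)) gE.
have := congr1 (fun t : {poly Fa} => t`_(size s).-1) gE.
rewrite !coefZ !coef_map coefPn_prod_XsubC; last by rewrite size_map -lt0n.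
move: lead_s; rewrite lead_coefE size_prod_XsubC /= size_map => ->.
rewrite mulr1 => e1 e2.
rewrite -e2 -mulrA in e1; move/(mulfI nz1): e1.
have -> : \sum_(z <- s) z = x *+ size r + (\sum_(i <- r) i)%:R.
  by rewrite big_map big_split /= natr_sum big_const_seq count_predT iter_addr_0.
set S := (\sum_(i <- r) i)%N => e1.
have nzg : g`_(size r) != 0.
  by rewrite -(fmorph_eq0 iota); apply: contra_neq nz2 => gr0; rewrite -e2 gr0 mulr0.
have xE : x = iota (- (g`_(size r).-1 / g`_(size r) + S%:R) / (size r)%:R).
  rewrite fmorph_div rmorphN rmorphD fmorph_div e1 /= !rmorph_nat.
  rewrite [iota _ * _]mulrC mulfK ?fmorph_eq0 //.
  rewrite opprD opprK addrK -[x *+ _]mulr_natr mulfK //.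
  by rewrite -(rmorph_nat iota) fmorph_eq0.
by have /eqP[] := no_root (- (g`_(size r).-1 / g`_(size r) + S%:R) / (size r)%:R);
   apply: (fmorph_inj iota); rewrite rmorphB rmorphXn /= -xE.
Qed.

(** If neither [a] nor [x] has the form [y ^+ p - y], adjoining a root [b] for [a] or a root [d] for
    [x] gives the same extension of degree [p], so [d] is a polynomial in [b]. The automorphism
    taking [b] to [b + 1], handled as substitution of ['X + 1], moves [d] by a prime field element
    [i]; hence [d - i * b] lies in [F]. *)
Lemma artin_schreier_cosets (a : F) :
  quasi_finite iota -> (forall y, y ^+ p - y != a) ->
  forall x, exists (i : nat) (y : F), (i < p)%N /\ x = y ^+ p - y + a *+ i.
Proof.
move=> [_ /(_ p (prime_gt0 (pcharf_prime pcharF))) [K [_ uniqK]]] a_no x.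
have p_prime := pcharf_prime pcharF; have p_gt0 := prime_gt0 p_prime.
have [[y xy] | x_no] := pselect (exists y, x = y ^+ p - y).
  by exists 0%N, y; rewrite mulr0n addr0.
have {}x_no y : y ^+ p - y != x by apply/eqP => xy; apply: x_no; exists y.
have rootFa c : exists z, root (map_poly iota (artin_schreier_poly p c)) z.
  apply/closed_rootP; rewrite size_map_poly size_artin_schreier_poly //.
  by rewrite eqSS gtn_eqF.
have [b qb] := rootFa a; have [d qd] := rootFa x.
have irr_a := artin_schreier_irreducible a_no.
have irr_x := artin_schreier_irreducible x_no.
have : adjoin_root iota d d by exists 'X; rewrite ?map_polyX ?hornerX.
rewrite -(uniqK _ (adjoin_root_extension irr_x qd (size_artin_schreier_poly pcharF x))).
rewrite (uniqK _ (adjoin_root_extension irr_a qb (size_artin_schreier_poly pcharF a))).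
move=> [r0 _ r0d].
(* Reduction modulo [q] brings the degree below [p]: divisibility by [q] will then force an
   equality, and periodicity a constant. *)
pose q := artin_schreier_poly p a; pose r := r0 %% q.
have size_q : size q = p.+1 by apply: size_artin_schreier_poly.
have le_rp : (size r <= p)%N by rewrite -ltnS -size_q ltn_modp -size_poly_eq0 size_q.
have {r0d} rd : (map_poly iota r).[b] = d.
  rewrite -r0d [in RHS](divp_eq r0 q) rmorphD rmorphM hornerD hornerM (eqP qb).
  by rewrite mulr0 add0r.
move: (qb) (qd); rewrite !map_artin_schreier_poly !root_artin_schreier_poly.
move=> /eqP ba /eqP dx.
pose r1 := r \Po ('X + 1).
have : q %| r ^+ p - r - x%:P.
  rewrite -(root_irreducible_dvdp irr_a qb) !rmorphB rmorphXn /= map_polyC.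
  by rewrite !hornerE rd dx subrr.
(* The substitution fixes [q], so the divisibility passes from [r] to [r1]: the value [d1] of [r1]
   at [b] is again a root of the polynomial for [x]. *)
have qX : q \Po ('X + 1) = q.
  rewrite /q /artin_schreier_poly !comp_polyB comp_polyC comp_polyX comp_Xn_poly.
  rewrite exprDn_pchar; last by rewrite (eq_pnat _ (pchar_poly F)) pnatE.
  by rewrite expr1n opprD addrACA subrr addr0.
move/(dvdp_comp_poly ('X + 1)); rewrite qX !comp_polyB comp_polyC rmorphXn /=.
rewrite -/r1 -(root_irreducible_dvdp irr_a qb) !rmorphB rmorphXn /= map_polyC.
rewrite 2!hornerD 2!hornerN horner_exp hornerC [X in _ - X == 0](esym dx).
set d1 := (map_poly iota r1).[b] => /eqP d1x.
have [|i ltip d1d] := @pchar_fixedP _ _ pcharFa (d1 - d).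
  rewrite exprB_pchar //; apply/eqP; rewrite -subr_eq0 -d1x; apply/eqP.
  by rewrite !opprD !opprK addrACA.
have : q %| r1 - r - i%:R%:P.
  rewrite -(root_irreducible_dvdp irr_a qb) !rmorphB /= map_polyC !hornerE.
  by rewrite rd -/d1 d1d [X in _ - X](rmorph_nat iota) subrr.
have size_r1 : (size (r1 - r - i%:R%:P)%R <= p)%N.
  rewrite (leq_trans (size_polyD _ _)) // size_polyN geq_max.
  rewrite (leq_trans (size_polyC_leq1 _)) // andbT.
  rewrite (leq_trans (size_polyD _ _)) // size_polyN geq_max le_rp andbT.
  by rewrite size_comp_poly2 // size_XaddC.
have [/eqP|nz /(dvdp_leq nz)] := eqVneq (r1 - r - i%:R%:P) 0; last first.
  by rewrite size_q leqNgt ltnS size_r1.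
rewrite -addrA -opprD subr_eq0 => /eqP r1E _.
(* The substitution adds [i] to both terms, so their difference is periodic. *)
pose s := r - i%:R *: 'X.
have /periodic_poly_const : s \Po ('X + 1) = s.
  rewrite comp_polyB comp_polyZ comp_polyX -/r1 r1E scalerDr opprD addrA.
  by rewrite alg_polyC addrAC addrK.
move=> /(_ _ pcharF) sC.
have {}sC : s = s.[0]%:P.
  apply: sC; rewrite (leq_trans (size_polyD _ _)) // size_polyN geq_max le_rp.
  by rewrite (leq_trans (size_scale_leq _ _)) // size_polyX prime_gt1.
exists i, s.[0]; split=> //; apply: (fmorph_inj iota).
have dE : d = iota s.[0] + iota i%:R * b.
  have := congr1 (fun t => (map_poly iota t).[b]) sC.
  rewrite rmorphB /= map_polyZ map_polyX map_polyC !hornerE rd => <-.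
  by rewrite subrK.
rewrite -dx dE rmorph_nat rmorphD rmorphB rmorphXn rmorphMn.
rewrite [X in _ + X *+ i](esym ba).
rewrite exprD_pchar // exprMn natr_expr_pchar // !mulr_natl mulrnBl.
by rewrite opprD addrACA.
Qed.

(** Multiplication by a nonzero [x] permutes the [n - 1] nonzero elements of the subfield; the
    product of these elements is nonzero and can be cancelled. *)
Lemma finite_subfield_expr n (x : Fa) : finite_subfield Fa n x -> x ^+ n = x.
Proof.
move=> [K [[K1 KB KV] /card_set_bijP[f [fK f_inj f_surj]] Kx]].
have /choice[g gP] (i : nat) : exists y, (i < n)%N -> K y /\ f y = i.
  have [lti | _] := boolP (i < n)%N; last by exists 0.
  by have [y Ky fy] := f_surj i lti; exists y.
pose s := [seq g i | i <- seq.iota 0 n].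
have uniq_s : uniq s.
  rewrite map_inj_in_uniq ?iota_uniq // => i j; rewrite !mem_iota !add0n.
  by move=> /gP[_ {2}<-] /gP[_ {2}<-] ->.
have memK y : (y \in s) = (y \in K).
  apply/mapP/idP => [[i] | ].
    by rewrite mem_iota add0n => /gP[Kg _] ->; rewrite inE.
  rewrite inE => Ky; have /gP[Kg fg] := fK y Ky; exists (f y).
    by rewrite mem_iota; apply: fK.
  by apply: f_inj; rewrite ?inE.
have KM y z : y \in K -> z \in K -> y * z \in K.
  move=> Ky Kz; rewrite -[z]invrK; apply: (KV _ _ Ky).
  by have := KV _ _ K1 Kz; rewrite div1r.
have size_s : size s = n by rewrite size_map size_iota.
have n_gt0 : (0 < n)%N.
  by rewrite -size_s; have := memK 1; rewrite K1; case: (s).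
have [-> | nz_x] := eqVneq x 0; first by rewrite expr0n gtn_eqF.
have K0 : 0 \in s by rewrite memK -(subrr 1); apply: KB.
pose t := rem 0 s.
have mem_t y : (y \in t) = (y != 0) && (y \in s) by rewrite mem_rem_uniq.
have uniq_t : uniq t by apply: rem_uniq.
have perm_t : perm_eq [seq x * y | y <- t] t.
  have uniq_xt : uniq [seq x * y | y <- t] by rewrite map_inj_uniq //; apply: mulfI.
  have [||_ eq_t] := uniq_min_size uniq_xt (s2 := t); rewrite ?size_map //.
    move=> _ /mapP[y + ->]; rewrite !mem_t !memK => /andP[nz_y Ky].
    by rewrite mulf_neq0 // KM // inE.
  exact: uniq_perm.
have : \prod_(y <- t) y != 0.
  by rewrite prodf_seq_neq0; apply/allP => y; rewrite mem_t => /andP[].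
move/mulIf; apply; rewrite -[in RHS](perm_big _ perm_t) /= big_map big_split /=.
rewrite big_const_seq count_predT iter_mulr_1 size_rem // size_s.
by rewrite mulrA -exprS prednK.
Qed.

(* [y |-> y ^+ p - y] is Frobenius minus the identity, so its [p ^ n]-th
   iterate is [y |-> y ^+ (p ^ (p ^ n)) - y]. *)
Lemma exists_non_artin_schreier :
  ~ (max_abelian_pext Fa p `<=` range iota) ->
  exists a : F, forall y, y ^+ p - y != a.
Proof.
move=> not_sub; apply: contrapT => no_a; apply: not_sub.
have surj (a : F) : exists y, y ^+ p - y = a.
  apply: contrapT => a_no; apply: no_a; exists a => y.
  by apply/eqP => ya; apply: a_no; exists y.
move=> x [n _ /finite_subfield_expr xq].
pose frob k := x ^+ (p ^ k).
(* The shift along [frob] is Frobenius, so each further difference applies Frobenius minus the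
   identity once more. *)
have frobS k j : iter_diff k frob j.+1 = iter_diff k frob j ^+ p.
  elim: k j => [|k IHk] j /=; first by rewrite /frob expnSr exprM.
  by rewrite !IHk exprB_pchar.
have descent k : range iota (iter_diff k frob 0) -> range iota x.
  elim: k => [|k IHk] //= [a _ aE]; apply: IHk.
  move: aE; rewrite frobS; set z := iter_diff k frob 0 => aE.
  have [y ya] := surj a.
  (* [z] and [iota y] have the same image under Frobenius minus the identity, so they differ by an
     element of the prime field. *)
  have [|i _ zy] := @pchar_fixedP _ _ pcharFa (z - iota y).
    apply/eqP; rewrite exprB_pchar // -subr_eq0 opprD addrACA -opprD -aE -ya.
    by rewrite rmorphB rmorphXn /= subrr.
  by exists (i%:R + y) => //; rewrite rmorphD rmorph_nat -zy subrK.
apply: (descent (p ^ n)%N); exists 0 => //; rewrite rmorph0 iter_diff_pchar_nat.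
  by rewrite /frob xq expn0 expr1 subrr.
by rewrite pnatX pnatE ?(pcharf_prime pcharF) // pcharFa.
Qed.

End ArtinSchreier.

(** * Environments and transfer of first-order facts *)

Section EnvCons.
Variables (X : Type) (n : nat).
Implicit Types (a : X) (v : 'I_n -> X).

Lemma env_cons0 a v : env_cons a v ord0 = a.
Proof. by rewrite /env_cons unlift_none. Qed.

Lemma env_consS a v i : env_cons a v (lift ord0 i) = v i.
Proof. by rewrite /env_cons liftK. Qed.

Lemma env_cons_eta (w : 'I_n.+1 -> X) :
  env_cons (w ord0) (fun i => w (lift ord0 i)) = w.
Proof. by apply/funext => i; rewrite /env_cons; case: unliftP => [j|] ->. Qed.

End EnvCons.

Definition env_consE := (env_cons0, env_consS).

Arguments env_cons : simpl never.

Lemma env0_eq (X : Type) (v w : 'I_0 -> X) : v = w.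
Proof. by apply/funext => -[]. Qed.

(** A theory holds sentences only, so free variables are closed off by universal quantifiers one at
    a time. This is how identities of [F] reach [M], which carries no ring axioms of its own. *)
Lemma valid_transfer (M N : rstruct) : models_theory M (Th N) ->
  forall n (f : rformula n), (forall v : 'I_n -> N, sat f v) ->
  forall v : 'I_n -> M, sat f v.
Proof.
move=> MN; elim=> [|n IHn] f fN v.
  by rewrite (env0_eq v (fun=> rs_zero M)); apply: MN; apply: fN.
rewrite -(env_cons_eta v); apply: (IHn (FAll f)) => w a; exact: fN.
Qed.

Local Notation x0 := (TVar ord0).
Local Notation x1 := (TVar (lift ord0 ord0)).
Local Notation x2 := (TVar (lift ord0 (lift ord0 ord0))).
Local Notation x3 := (TVar (lift ord0 (lift ord0 (lift ord0 ord0)))).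

Definition elem_map (M : rstruct) (B : set M) (s : set_type B -> set_type B) :=
  forall n (f : rformula n) (b : 'I_n -> set_type B),
    sat f (fun i => val (b i)) <-> sat f (fun i => val (s (b i))).

(** * Elementary maps of order p *)

Section OrderP.
Variables (F : fieldType) (p : nat) (M : rstruct) (B : substruct M).
Hypothesis pcharF : p \in [pchar F].
Hypothesis MF : models_theory M (Th (ring_rstruct F)).
Variable s : set_type B -> set_type B.
Hypothesis elem_s : elem_map s.

Local Notation "x -' y" := (rs_add x (rs_opp y)) (at level 50).

Lemma rs_subKC (x y : M) : rs_add y (x -' y) = x.
Proof.
have := @valid_transfer _ _ MF 2 (FEq (TAdd x1 (TAdd x0 (TOpp x1))) x0).
move=> /(_ _ (env_cons x (env_cons y (fun=> rs_zero M)))) /=.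
by rewrite !env_consE; apply=> v; rewrite addrC subrK.
Qed.

Lemma rs_sub_eq0 (x y : M) : x -' y = rs_zero M -> x = y.
Proof.
have := @valid_transfer _ _ MF 2 (FImp (FEq (TAdd x0 (TOpp x1)) TZero) (FEq x0 x1)).
move=> /(_ _ (env_cons x (env_cons y (fun=> rs_zero M)))) /=.
by rewrite !env_consE; apply=> v /eqP; rewrite subr_eq0 => /eqP.
Qed.

Definition sub_id (x : set_type B) : set_type B :=
  in_subset (ss_add (set_mem (valP (s x))) (ss_opp (set_mem (valP x)))).

Lemma sub_id_comm x : s (sub_id x) = sub_id (s x).
Proof.
apply: val_inj => /=.
have [+ _] := @elem_s 3 (FEq x0 (TAdd x1 (TOpp x2)))
  (env_cons (sub_id x) (env_cons (s x) (env_cons x (fun=> x)))).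
by rewrite /= !env_consE; apply.
Qed.

(** [iter_diff] at the level of terms, so that its vanishing becomes a formula that can be
    transferred. *)
Fixpoint diff_term n (t : nat -> rterm n) (k j : nat) : rterm n :=
  if k is l.+1 then TAdd (diff_term t l j.+1) (TOpp (diff_term t l j)) else t j.

Lemma teval_diff_term n (t : nat -> rterm n) k j (v : 'I_n -> ring_rstruct F) :
  teval (diff_term t k j) v = iter_diff k (fun l => teval (t l) v : F) j.
Proof. by elim: k j => //= k IHk j; rewrite !IHk. Qed.

Hypothesis order_s : forall x, iter p s x = x.

(** The expansion of the [p]-th power of [s - 1] is an identity of [F] in [p] variables, which stand
    for the orbit of [x]; it transfers to [M]. *)
Lemma sub_id_nilpotent x : val (iter p sub_id x) = rs_zero M.
Proof.
have p_gt0 := prime_gt0 (pcharf_prime pcharF).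
(* Reducing the index modulo [p] builds in that [s] has order [p]: indices [p] and 0 name the same
   variable. *)
pose t k : rterm p := TVar (Ordinal (ltn_pmod k p_gt0)).
have := @valid_transfer _ _ MF p (FEq (diff_term t p 0) TZero).
move=> /(_ _ (fun i => val (iter i s x))) valid.
have iter_mod j : iter (j %% p) s x = iter j s x.
  rewrite [in RHS](divn_eq j p) addnC iterD; congr iter.
  by elim: (_ %/ _)%N => //= k IHk; rewrite mulSn iterD -IHk order_s.
have iter_comm j y : iter j s (sub_id y) = sub_id (iter j s y).
  by elim: j => //= j ->; rewrite sub_id_comm.
have tE k j : teval (diff_term t k j) (fun i => val (iter i s x)) =
              val (iter j s (iter k sub_id x)).
  elim: k j => [|k IHk] j /=; first by rewrite iter_mod.
  by rewrite !IHk iter_comm.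
rewrite -[iter p _ _]/(iter 0 s _) -tE; apply: valid => v /=.
rewrite teval_diff_term iter_diff_pchar_nat ?pnatE ?(pcharf_prime pcharF) //=.
apply/eqP; rewrite subr_eq0; apply/eqP; congr v; apply: val_inj.
by rewrite /= modnn mod0n.
Qed.

Lemma exists_unipotent_pair x : s x <> x ->
  exists u v : set_type B, [/\ val v <> rs_zero M, s v = v
    & val (s u) = rs_add (val u) (val v)].
Proof.
move=> sx; have p_gt0 := prime_gt0 (pcharf_prime pcharF).
(* The least exponent killing [x] is sought in the form [m.+1]. Exponent 1 would give [s x = x], so
   it is at least 2, and [u], [v] are the last two iterates before it. *)
have exP : exists m, `[< val (iter m.+1 sub_id x) = rs_zero M >].
  by exists p.-1; apply/asboolP; rewrite prednK // sub_id_nilpotent.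
case: (ex_minnP exP) => -[|m] /asboolP /= m0 min_m.
  by case: sx; apply: val_inj; apply: rs_sub_eq0.
exists (iter m sub_id x), (iter m.+1 sub_id x); split => /=.
- by move=> v0; have := min_m m; rewrite ltnn => /(_ _)/negP; apply=> //; apply/asboolP.
- by apply: val_inj; apply: rs_sub_eq0.
- by rewrite rs_subKC.
Qed.

End OrderP.

(** * A formula separating Artin-Schreier cosets *)

Section Formula.
Variable p : nat.

Fixpoint pow_term n (t : rterm n) k : rterm n :=
  if k is l.+1 then TMul t (pow_term t l) else TOne.

Fixpoint muln_term n (t : rterm n) k : rterm n :=
  if k is l.+1 then TAdd t (muln_term t l) else TZero.

Fixpoint bigor n (f : nat -> rformula n) k : rformula n :=
  if k is l.+1 then FOr (bigor f l) (f l) else FFalse.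

Lemma teval_pow_term (M : rstruct) n (t : rterm n) k (v : 'I_n -> M) :
  teval (pow_term t k) v = iter k (rs_mul (teval t v)) (rs_one M).
Proof. by elim: k => //= k ->. Qed.

Lemma teval_muln_term (M : rstruct) n (t : rterm n) k (v : 'I_n -> M) :
  teval (muln_term t k) v = iter k (rs_add (teval t v)) (rs_zero M).
Proof. by elim: k => //= k ->. Qed.

Lemma sat_bigor (M : rstruct) n (f : nat -> rformula n) k (v : 'I_n -> M) :
  sat (bigor f k) v <-> exists2 i, (i < k)%N & sat (f i) v.
Proof.
elim: k => [|k IHk] /=; first by split=> // -[].
split=> [[/IHk[i ltik fi] | fk] | [i]].
- by exists i => //; apply: ltnW.
- by exists k.
- rewrite ltnS leq_eqVlt => /predU1P[-> | ltik] fi; first by right.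
  by left; apply/IHk; exists i.
Qed.

(* In the variables [v, u, a]: [a * num / v] lies in the coset
   [i * a + {y ^+ p - y}]. *)
Definition coset_formula (i : nat) (num : rterm 4) : rformula 3 :=
  FEx (FEq (TMul x3 num)
           (TMul x1 (TAdd (TAdd (pow_term x0 p) (TOpp x0)) (muln_term x3 i)))).

(** With [a] free and [c = u / v]: some coset index below [p] fits [a * c] but not [a * (c + 1)].
    Denominators are cleared to stay in the language of rings. *)
Definition separating_formula : rformula 1 :=
  FAll (FAll (FOr (FEq x0 TZero)
    (bigor (fun i => FAnd (coset_formula i x2)
                          (FNot (coset_formula i (TAdd x2 x1)))) p))).

(** Were [a * c] and [a * (c + 1)] in the same coset, their difference [a] would have the form
    [w ^+ p - w]. *)
Lemma separating_formula_holds (F : fieldType) (a : F) : p \in [pchar F] ->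
  (forall y, y ^+ p - y != a) ->
  (forall x, exists (i : nat) (y : F), (i < p)%N /\ x = y ^+ p - y + a *+ i) ->
  @sat (ring_rstruct F) 1 separating_formula (fun=> a).
Proof.
move=> pcharF a_no cosets u v.
have [v0 | nz_v] := eqVneq v 0; [left | right].
  by rewrite /= env_consE.
apply/sat_bigor; have [i [y [ltip yE]]] := cosets (a * u / v).
have powE k (z : F) : iter k (fun x => z * x) 1 = z ^+ k.
  by elim: k => //= k ->; rewrite exprS.
have mulnE k (z : F) : iter k (fun x => z + x) 0 = z *+ k.
  by elim: k => //= k ->; rewrite mulrS.
exists i => //=; split.
  exists y; rewrite teval_pow_term teval_muln_term /= !env_consE powE mulnE -yE.
  by rewrite [RHS]mulrC divfK.
move=> [z]; rewrite teval_pow_term teval_muln_term /= !env_consE powE mulnE => zE.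
have /eqP[] := a_no (z - y); rewrite exprB_pchar //; apply: (mulfI nz_v).
have uE : v * (y ^+ p - y + a *+ i) = a * u by rewrite -yE mulrC divfK.
transitivity (v * (z ^+ p - z + a *+ i) - v * (y ^+ p - y + a *+ i)).
  rewrite -mulrBr; congr (_ * _).
  by rewrite [in RHS]opprD addrACA subrr addr0 [in RHS]opprD addrACA -opprD.
by rewrite -zE uE mulrDr addrAC subrr add0r mulrC.
Qed.

Lemma separating_formula_fixed (M : rstruct) (B : set M) s (a u v : set_type B) :
  elem_map s -> @sat M 1 separating_formula (fun=> val a) -> s a = a ->
  val v <> rs_zero M -> s v = v -> val (s u) <> rs_add (val u) (val v).
Proof.
move=> elem_s sep sa nz_v sv su.
have [|/sat_bigor[i _ [+ []]]] := sep (val u) (val v); first by rewrite /= env_consE.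
have [ih _] := elem_s _ (coset_formula i x2) (env_cons v (env_cons u (fun=> a))).
move=> [y yE]; have [|z zE] := ih; [exists y | exists z].
  by move: yE; rewrite /= !teval_pow_term !teval_muln_term /= !env_consE.
by move: zE; rewrite /= !teval_pow_term !teval_muln_term /= !env_consE sa sv su.
Qed.

End Formula.

(** * Cyclic automorphism groups of order p are excluded *)

Theorem theorem8 (F : fieldType) (Fa : closedFieldType)
    (iota : {rmorphism F -> Fa}) (p : nat) :
  is_algebraic_closure iota ->
  quasi_finite iota ->
  p \in [pchar F] ->
  ~ (max_abelian_pext Fa p `<=` range iota) ->
  ~ geometrically_represented (Th (ring_rstruct F)) p.
Proof.
move=> _ qfF pcharF /exists_non_artin_schreier [//|a0 a0_no].
move=> [M [M0 [A [B [MF M0M [M0A AB _] [h [inj_h range_h hD]]]]]]].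
have p_gt1 := prime_gt1 (pcharf_prime pcharF).
have autP i : @elem_aut M A B (h i) by rewrite -range_h; exists i.
(* [h 0] is an idempotent bijection, hence the identity. *)
have h0 x : h 0 x = x.
  have [[g gK _] _ _] := autP 0.
  by rewrite -[LHS]gK -[h 0 (h 0 x)]/((h 0 \o h 0) x) -hD addr0 gK.
have [_ fixA elem_h1] := autP 1.
have iter_h1 k x : iter k (h 1) x = h k%:R x.
  by elim: k => [|k IHk] /=; rewrite ?h0 // IHk -natr1 addrC hD.
have [x h1x] : exists x, h 1 x <> x.
  apply: contrapT => no_x; have /eqP := oner_neq0 'Z_p; apply; apply: inj_h.
  apply/funext => x; rewrite h0; apply: contrapT => h1x; apply: no_x.
  by exists x.
have order_h1 y : iter p (h 1) y = y by rewrite iter_h1 pchar_Zp.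
have [u [v [nz_v sv su]]] := exists_unipotent_pair pcharF MF elem_h1 order_h1 h1x.
have env1 (X : Type) (y : X) (w : 'I_0 -> X) : env_cons y w = fun=> y.
  by apply/funext => i; rewrite ord1 env_cons0.
(* That a separating element exists is a sentence, so it passes from [F] to [M] and down to [M0]; a
   witness in [M0] lies in [A] and is fixed by [h 1]. *)
have sepM : models M (FEx (separating_formula p)).
  apply: MF; exists a0; rewrite env1.
  exact: separating_formula_holds (artin_schreier_cosets pcharF qfF a0_no).
have [_ toM0] := M0M 0 (FEx (separating_formula p))
  (fun=> rs_zero (induced_rstruct M0)).
have [|a] := toM0; first by rewrite [X in sat _ X](env0_eq _ (fun=> rs_zero M)).
rewrite env1 => sep0.
have [/(_ sep0) sep _] := M0M 1 (separating_formula p) (fun=> a).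
have Ba : ss_set B (val a) := AB _ (M0A _ (set_mem (valP a))).
apply: (separating_formula_fixed elem_h1 (a := in_subset Ba) sep _ nz_v sv su).
exact/fixA/M0A/(set_mem (valP a)).
Qed.
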